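(* $f_3(5,4)=\frac{16}{7}=\rho_3(G^* )$, where $G^*$ is the $7$-vertex graph obtained from $K_6$ by deleting the two edges of a matching $\{wx,yz\}$ and adding a new vertex adjacent exactly to $w,x,y,z$.
   Context: $\mathcal{G}(\Delta,\omega)$ denotes the class of finite simple graphs $G$ with maximum degree $\Delta(G)\le\Delta$ and clique number $\omega(G)\le\omega$. $k_t(G)$ is the number of copies of $K_t$ in $G$ and $\rho_t(G)=k_t(G)/|V(G)|$. $f_t(\Delta,\omega)=\sup\{\rho_t(G): G\in\mathcal{G}(\Delta,\omega),\ |V(G)|\ge 1\}$. *)

(* Defs.v *)
From HB Require Import structures.
From mathcomp Require Import all_boot all_order all_algebra.
Set Implicit Arguments. Unset Strict Implicit. Unset Printing Implicit Defensive.
Import Order.TTheory GRing.Theory Num.Theory.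

Definition simple_graph (T : finType) (e : rel T) : Prop :=
  symmetric e /\ irreflexive e.

Definition is_clique (T : finType) (e : rel T) (S : {set T}) : bool :=
  [forall x in S, forall y in S, (x != y) ==> e x y].

Definition k_ (t : nat) (T : finType) (e : rel T) : nat :=
  #|[set S : {set T} | (#|S| == t) && is_clique e S]|.

Definition rho_ (t : nat) (T : finType) (e : rel T) : rat :=
  (k_ t e)%:R / #|T|%:R.

Definition deg (T : finType) (e : rel T) (x : T) : nat := #|[set y | e x y]|.

Definition in_class (Delta omega : nat) (T : finType) (e : rel T) : Prop :=
  simple_graph e /\
  (forall x : T, deg e x <= Delta)%N /\
  (forall S : {set T}, is_clique e S -> #|S| <= omega)%N.

Definition f_eq (t Delta omega : nat) (r : rat) : Prop :=
  (forall (T : finType) (e : rel T), in_class Delta omega e -> (0 < #|T|)%N ->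
      (rho_ t e <= r)%R) /\
  (forall r' : rat,
      (forall (T : finType) (e : rel T), in_class Delta omega e -> (0 < #|T|)%N ->
          (rho_ t e <= r')%R) -> (r <= r')%R).

(* G*: vertices 0..6; 0..5 induce K_6 minus the matching {01, 23}
   (w=0, x=1, y=2, z=3); vertex 6 is adjacent exactly to 0,1,2,3. *)
Definition Gstar_adj (i j : nat) : bool :=
  if (i < 6) && (j < 6) then
    (i != j) && ~~ ([&& i < 2 & j < 2] || [&& 2 <= i < 4 & 2 <= j < 4])
  else if i == 6 then j < 4
  else if j == 6 then i < 4
  else false.

Definition Gstar : rel 'I_7 := fun i j => Gstar_adj i j.

(* Main.v *)
Require Import Defs.
From HB Require Import structures.
From mathcomp Require Import all_boot all_order all_algebra.
From mathcomp Require Import zify.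
Import Order.TTheory GRing.Theory Num.Theory.
Set Implicit Arguments. Unset Strict Implicit. Unset Printing Implicit Defensive.

(** Discharging. Let [tri x] be the number of edges inside the neighbourhood of
    [x], so that the [tri x] add up to three times the number of triangles; we
    need an average of at most 48/7. The neighbourhood of [x] has at most five
    vertices and contains no [K_4], hence [tri x <= 8].

    If [tri u = 8], the neighbourhood of [u] is a 4-cycle [a b a' b'] plus a hub
    [v], and [v] is a closed twin of [u]. Each vertex of the cycle then has at
    most one neighbour outside this block; it has [tri <= 7], with equality only
    if its outside neighbour is also joined to its two neighbours on the cycle,
    in which case that outside vertex has [tri <= 4]. If [tri v = 7] and no
    neighbour of [v] has [tri = 8], then some neighbour of [v] has [tri <= 6].

    So a vertex with [tri = 8] sends 2 to each of its four cycle vertices; a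
    vertex with [tri = 7] sends 5 to each neighbour with [tri <= 4] and, unless
    it lies in a block, 1 to each neighbour with [tri] equal to 5 or 6. After
    this no vertex has charge [7 tri x - 48] above 0. *)

(** * Counting the edges that a relation spans on a list *)

Fixpoint edges (U : Type) (r : rel U) (s : seq U) : nat :=
  if s is x :: s' then count (r x) s' + edges r s' else 0.

Lemma edges_map (U V : Type) (f : U -> V) (r : rel V) (s : seq U) :
  edges r (map f s) = edges (relpre f r) s.
Proof. by elim: s => //= x s ->; rewrite count_map. Qed.

Lemma eq_in_edges (U : eqType) (r r' : rel U) (s : seq U) :
  {in s &, r =2 r'} -> edges r s = edges r' s.
Proof.
elim: s => //= x s IH H; rewrite IH; last first.
  by move=> y z ys zs; apply: H; rewrite inE ?ys ?zs orbT.
congr (_ + _); apply: eq_in_count => y ys.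
by apply: H; rewrite !inE ?eqxx ?ys ?orbT.
Qed.

Lemma sum_count (U : eqType) (p : pred U) (s : seq U) :
  \sum_(x <- s) p x = count p s.
Proof. by rewrite -sum1_count [RHS]big_mkcond; apply: eq_bigr => x _; case: (p x). Qed.

Lemma edges_double (U : eqType) (r : rel U) (s : seq U) :
  symmetric r -> irreflexive r ->
  \sum_(x <- s) count (r x) s = (edges r s).*2.
Proof.
move=> sym irr; elim: s => [|x s IH]; first by rewrite big_nil.
rewrite big_cons /= irr add0n big_split /= IH.
under eq_bigr => y _ do rewrite sym.
by rewrite sum_count doubleD -!addnn addnA.
Qed.

Lemma perm_edges (U : eqType) (r : rel U) (s s' : seq U) :
  symmetric r -> irreflexive r -> perm_eq s s' -> edges r s = edges r s'.
Proof.
move=> sym irr ss'; apply: double_inj; rewrite -!edges_double //.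
rewrite (perm_big _ ss') /=; apply: eq_bigr => x _.
by apply/permP.
Qed.

(** * Graphs on five vertices without [K_4] and with at least seven edges *)

(* Bit [j (j - 1) / 2 + i] of [m] tells whether [i < j] are adjacent. *)
Definition adj (m : bitseq) : rel nat := fun i j =>
  (i != j) && nth false m ('C(maxn i j, 2) + minn i j).

Definition wheel_link (U : Type) (r : rel U) (s : seq U) : bool :=
  if s is [:: h; a; a'; b; b'] then
    [&& r h a, r h a', r h b, r h b', r a b, r a b', r a' b, r a' b',
        ~~ r a a' & ~~ r b b']
  else false.

(* The dense links with 7 edges are the complements, within [K_5], of a triangle,
   of a path on four vertices, and of the disjoint union of a path on three
   vertices and an edge; the first two share the features in [coned_link]. *)
Definition coned_link (U : Type) (r : rel U) (s : seq U) : bool :=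
  if s is [:: h; p; q; y; z] then
    [&& r h p, r h q, r h y, r h z, r p q, ~~ r p y & ~~ r p z]
  else false.

Definition coneless_link (U : Type) (r : rel U) (s : seq U) : bool :=
  if s is [:: p; p'; p''; q; q'] then
    [&& r p p', r p q, r p q', r p' q, r p' q', r p'' q, r p'' q',
        ~~ r p p'', ~~ r p' p'' & ~~ r q q']
  else false.

Definition dense_link (U : Type) (r : rel U) (s : seq U) : bool :=
  (edges r s == 8) && wheel_link r s
  || (edges r s == 7) && (coned_link r s || coneless_link r s).

(* Only meaningful for lists of length 5. *)
Definition has_K4 (U : Type) (r : rel U) (s : seq U) : bool :=
  if s is [:: a; b; c; d; x] then
    [|| pairwise r [:: a; b; c; d], pairwise r [:: a; b; c; x],
        pairwise r [:: a; b; d; x], pairwise r [:: a; c; d; x]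
      | pairwise r [:: b; c; d; x]]
  else false.

Fixpoint bitseqs (n : nat) : seq bitseq :=
  if n is n'.+1 then map (cons true) (bitseqs n') ++ map (cons false) (bitseqs n')
  else [:: [::]].

Lemma mem_bitseqs (m : bitseq) : m \in bitseqs (size m).
Proof.
elim: m => //= b m IH; rewrite mem_cat.
by case: b; rewrite map_f ?orbT.
Qed.

(* [if] rather than [||]: call-by-value evaluation would enumerate the 120
   orderings for every one of the 1024 graphs. *)
Lemma dense_link_check :
  all (fun m => if has_K4 (adj m) (iota 0 5) then true else
                if edges (adj m) (iota 0 5) < 7 then true else
                has (dense_link (adj m)) (permutations (iota 0 5))) (bitseqs 10).
Proof. by vm_compute. Qed.

Lemma dense_link_adj (m : bitseq) (s := iota 0 5) :
  size m = 10 -> 7 <= edges (adj m) s -> ~~ has_K4 (adj m) s ->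
  exists2 p, perm_eq p s & dense_link (adj m) p.
Proof.
move=> m10 ge7 /negPf nK4; have := mem_bitseqs m; rewrite m10.
move/(allP dense_link_check); rewrite -/s nK4 ltnNge ge7 => /hasP[p].
by rewrite mem_permutations; exists p.
Qed.

(** The graph on [s] is coded by a bit sequence on positions, where the finite check applies; the
    ordering found there is mapped back through [nth]. *)
Lemma dense_linkP (U : eqType) (r : rel U) (s : seq U) :
  symmetric r -> irreflexive r -> size s = 5 -> 7 <= edges r s -> ~~ has_K4 r s ->
  exists2 s', perm_eq s' s & dense_link r s'.
Proof.
move=> sym irr s5 ge7 nK4.
case: s s5 ge7 nK4 => [|x0 [|x1 [|x2 [|x3 [|x4 [|//]]]]]] // _.
set s := [:: x0; x1; x2; x3; x4].
(* The pairs stand in colexicographic order, as [adj] expects. *)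
set m := [:: r x0 x1; r x0 x2; r x1 x2; r x0 x3; r x1 x3; r x2 x3;
             r x0 x4; r x1 x4; r x2 x4; r x3 x4].
have adjE i j : i < 5 -> j < 5 -> adj m i j = r (nth x0 s i) (nth x0 s j).
  by case: i => [|[|[|[|[|//]]]]] _; case: j => [|[|[|[|[|//]]]]] _;
     rewrite ?irr // sym.
have sE : s = map (nth x0 s) (iota 0 5) by [].
have -> : has_K4 r s = has_K4 (adj m) (iota 0 5) by rewrite /= !adjE.
have -> : edges r s = edges (adj m) (iota 0 5).
  rewrite [in LHS]sE edges_map; apply/esym/eq_in_edges => i j.
  by rewrite !mem_iota => /andP[_ ?] /andP[_ ?]; apply: adjE.
move=> ge7 nK4; have [//|p pP dl] := dense_link_adj _ ge7 nK4.
exists (map (nth x0 s) p); first by rewrite [X in perm_eq _ X]sE perm_map.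
have {}adjE : {in p &, adj m =2 relpre (nth x0 s) r}.
  by move=> i j; rewrite !(perm_mem pP) !mem_iota => ? ?; apply: adjE.
move: dl; rewrite /dense_link edges_map (eq_in_edges adjE).
have := perm_size pP; case: p {pP} adjE => [|a [|b [|c [|d [|x [|//]]]]]] // adjE _.
by rewrite /wheel_link /coned_link /coneless_link /= !adjE ?inE ?eqxx ?orbT.
Qed.

(** Four vertices can span six edges only as a [K_4]. *)
Lemma edges_le5 (U : Type) (r : rel U) (s : seq U) :
  size s <= 4 -> (size s = 4 -> ~~ pairwise r s) -> edges r s <= 5.
Proof.
case: s => [|a [|b [|c [|d [|//]]]]] //= _.
- by case: (r a b).
- by case: (r a b); case: (r a c); case: (r b c).
move=> /(_ erefl); case: (r a b); case: (r a c); case: (r a d);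
  by case: (r b c); case: (r b d); case: (r c d).
Qed.

Local Ltac split_andb :=
  repeat match goal with
  | H : is_true (_ && _) |- _ => case/andP: H => ? ?
  | |- is_true (_ && _) => apply/andP; split
  end.

(** * Links of vertices and their edge counts *)

Section Graph.

Variables (T : finType) (e : rel T).
Hypotheses (sym : symmetric e) (irr : irreflexive e).
Hypothesis deg_le5 : forall x, deg e x <= 5.
Hypothesis clique_le4 : forall S : {set T}, is_clique e S -> #|S| <= 4.

Definition nbrs (x : T) : seq T := enum [set y | e x y].

Definition tri (x : T) : nat := edges e (nbrs x).

Lemma mem_nbrs x y : (y \in nbrs x) = e x y.
Proof. by rewrite mem_enum inE. Qed.

Lemma uniq_nbrs x : uniq (nbrs x).
Proof. exact: enum_uniq. Qed.

Lemma size_nbrs x : size (nbrs x) <= 5.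
Proof. by rewrite -cardE; apply: deg_le5. Qed.

Lemma pairwise_size (s : seq T) : pairwise e s -> size s <= 4.
Proof.
move=> ps; rewrite -(card_uniqP (pairwise_uniq irr ps)) -cardsE.
apply: clique_le4; apply/'forall_implyP => x; rewrite inE => xs.
apply/'forall_implyP => y; rewrite inE => ys; apply/implyP.
elim: s ps xs ys => //= z s IH /andP[/allP ez ps]; rewrite !inE.
case/predU1P => [-> | xs] /predU1P[-> | ys]; rewrite ?eqxx // => xy.
- exact: ez.
- by rewrite sym; apply: ez.
exact: IH.
Qed.

Lemma tri_edges x s :
  uniq s -> (forall y, e x y = (y \in s)) -> tri x = edges e s.
Proof.
move=> us es; apply: perm_edges => //.
by apply: uniq_perm => // [|y]; rewrite ?uniq_nbrs ?mem_nbrs.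
Qed.

(** [R] collects the neighbours not yet known. The degree bound keeps it short, so computing [tri x]
    becomes a finite case analysis; if [s] has five elements, [R] is empty. *)
Lemma extend_nbrs x s : uniq s -> all (e x) s ->
  exists R, [/\ uniq (s ++ R), size R <= 5 - size s,
                forall y, e x y = (y \in s ++ R) & tri x = edges e (s ++ R)].
Proof.
move=> us /allP es; pose R := [seq y <- nbrs x | y \notin s]; exists R.
have uR : uniq (s ++ R).
  rewrite cat_uniq us filter_uniq ?uniq_nbrs // andbT /=.
  by apply/hasPn => y; rewrite mem_filter => /andP[].
have eR y : e x y = (y \in s ++ R).
  rewrite mem_cat /R mem_filter mem_nbrs.
  by case: (boolP (y \in s)) => //= /es.
split=> //; last exact: tri_edges.
suff : size (s ++ R) <= 5 by rewrite size_cat; lia.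
apply: leq_trans (size_nbrs x); apply: uniq_leq_size => // y.
by rewrite -eR mem_nbrs.
Qed.

Definition codeg (x y : T) : nat := count (e y) (nbrs x).

Lemma codegC x y : codeg x y = codeg y x.
Proof.
rewrite /codeg -!size_filter; apply/perm_size/uniq_perm => [||z].
- exact/filter_uniq/uniq_nbrs.
- exact/filter_uniq/uniq_nbrs.
by rewrite mem_filter mem_nbrs mem_filter mem_nbrs andbC.
Qed.

Lemma sum_codeg x : \sum_(y | e x y) codeg x y = (tri x).*2.
Proof.
rewrite -edges_double // /nbrs big_enum.
by apply: eq_bigl => y; rewrite inE.
Qed.

(** Without [y] the link of [x] has at most four vertices, which span at most five edges since a
    [K_4] there would form a [K_5] with [x]. *)
Lemma tri_le_codeg x y : e x y -> tri x <= codeg x y + 5.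
Proof.
move=> exy; have py : perm_eq (nbrs x) (y :: rem y (nbrs x)).
  by apply: perm_to_rem; rewrite mem_nbrs.
rewrite /codeg (permP py) /tri (perm_edges sym irr py) /= irr add0n leq_add2l.
have sR := perm_size py; have := size_nbrs x; rewrite sR /= ltnS => R4.
apply: edges_le5 => // R4'; apply/negP => pR.
have : size (x :: rem y (nbrs x)) <= 4.
  apply: pairwise_size; rewrite /= pR andbT; apply/allP => z /mem_rem.
  by rewrite mem_nbrs.
by rewrite /= R4'.
Qed.

(** Four or fewer neighbours would span at most five edges, and a [K_4] in the link would give a
    [K_5]; so [dense_linkP] applies. *)
Lemma dense_linkE x : 7 <= tri x ->
  exists s, [/\ uniq s, forall y, e x y = (y \in s) & dense_link e s].
Proof.
move=> ge7; have K4free s : {subset s <= e x} -> pairwise e s -> size s <= 3.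
  move=> sx ps; have : size (x :: s) <= 4; last by [].
  by apply: pairwise_size; rewrite /= ps andbT; apply/allP.
have sx : {subset nbrs x <= e x} by move=> y; rewrite mem_nbrs.
have s5 : size (nbrs x) = 5.
  apply/eqP; rewrite eqn_leq size_nbrs ltnNge; apply/negP => le4.
  suff : tri x <= 5 by lia.
  by apply: edges_le5 => // s4; apply/negP => /(K4free _ sx); rewrite s4.
have [|s ps dl] := dense_linkP sym irr s5 ge7.
  have := K4free; move: sx; case: (nbrs x) s5 => [|a [|b [|c [|d [|z [|//]]]]]] // _ sx Kf.
  have sub s : all [in [:: a; b; c; d; z]] s -> size s = 4 -> ~~ pairwise e s.
    move=> /allP ss s4; apply/negP => /Kf; rewrite s4 => F.
    by have: false by apply: F => y /ss/sx.
  rewrite /has_K4 !negb_or; do ?[apply/andP; split]; apply: sub => //;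
    by rewrite /= !inE !eqxx !orbT.
exists s; split=> // [|y]; first by rewrite (perm_uniq ps) uniq_nbrs.
by rewrite (perm_mem ps) mem_nbrs.
Qed.

Lemma tri_le8 x : tri x <= 8.
Proof.
rewrite leqNgt; apply/negP => gt8.
have [|s [us es]] := @dense_linkE x; first by lia.
by rewrite /dense_link -(tri_edges us es) !gtn_eqF // ltnW.
Qed.

(** * Blocks around a vertex with [tri] equal to 8 *)

(* [u] and [v] are the two hubs; [a a'] and [b b'] are the non-adjacent pairs. *)
Definition block (u v a a' b b' : T) : Prop :=
  [/\ uniq [:: u; v; a; a'; b; b'], wheel_link e [:: v; a; a'; b; b'],
      forall y, e u y = (y \in [:: v; a; a'; b; b']) &
      forall y, e v y = (y \in [:: u; a; a'; b; b'])].

Lemma tri8_block u : tri u = 8 -> exists v a a' b b', block u v a a' b b'.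
Proof.
move=> u8; have [|s [us es]] := @dense_linkE u; first by rewrite u8.
rewrite /dense_link -(tri_edges us es) u8 /= orbF.
case: s us es => [|v [|a [|a' [|b [|b' [|//]]]]]] // us es ol.
exists v, a, a', b, b'; split=> //.
  by rewrite cons_uniq us -es irr.
have [v_a v_a' v_b v_b'] : [/\ e v a, e v a', e v b & e v b'].
  by move: ol => /= /and5P[-> -> -> -> _].
(* Five known neighbours exhaust the degree of [v]. *)
have [||R [_ + es' _]] := @extend_nbrs v [:: u; a; a'; b; b'].
- have : u \notin [:: v; a; a'; b; b'] by rewrite -es irr.
  by rewrite inE => /norP[_ ua]; rewrite cons_uniq ua; case/andP: us.
- by rewrite /= sym es inE eqxx v_a v_a' v_b v_b'.
by rewrite leqn0 => /nilP R0 y; rewrite es' R0 cats0.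
Qed.

(** With [block_rot] this generates the symmetries of the 4-cycle, so facts about [a] carry over to
    [a'], [b] and [b']. *)
Lemma block_swap u v a a' b b' : block u v a a' b b' -> block u v a' a b b'.
Proof.
have pE x : perm_eq [:: x; a'; a; b; b'] [:: x; a; a'; b; b'].
  by apply/permP => p /=; lia.
case=> us ol eu ev; split=> [||y|y].
- by rewrite -(perm_uniq (s1 := [:: u; v; a; a'; b; b'])) //; apply/permP => p /=; lia.
- by move: ol; rewrite /wheel_link (sym a' a) => ol; split_andb.
- by rewrite (perm_mem (pE v)).
by rewrite (perm_mem (pE u)).
Qed.

Lemma block_rot u v a a' b b' : block u v a a' b b' -> block u v b b' a a'.
Proof.
have pE x : perm_eq [:: x; b; b'; a; a'] [:: x; a; a'; b; b'].
  by apply/permP => p /=; lia.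
case=> us ol eu ev; split=> [||y|y].
- by rewrite -(perm_uniq (s1 := [:: u; v; a; a'; b; b'])) //; apply/permP => p /=; lia.
- move: ol; rewrite /wheel_link (sym b a) (sym b a') (sym b' a) (sym b' a').
  by move=> ol; split_andb.
- by rewrite (perm_mem (pE v)).
by rewrite (perm_mem (pE u)).
Qed.

Lemma block_tri u v a a' b b' : block u v a a' b b' -> tri u = 8 /\ tri v = 8.
Proof.
case=> us ol eu ev; have us' : uniq [:: v; u; a; a'; b; b'].
  by rewrite -(perm_uniq (s1 := [:: u; v; a; a'; b; b'])) // (perm_catCA [:: u] [:: v]).
have [ua ua' ub ub'] : [/\ e u a, e u a', e u b & e u b'].
  by rewrite !eu !inE !eqxx !orbT.
rewrite (tri_edges _ eu) ?(tri_edges _ ev); [|by case/andP: us'|by case/andP: us].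
move: ol; rewrite /= ua ua' ub ub'.
case/and5P=> -> -> -> -> /and5P[-> -> -> -> /andP[/negPf-> /negPf->]].
by [].
Qed.

Lemma codegE x y s :
  uniq s -> (forall z, e x z = (z \in s)) -> codeg x y = count (e y) s.
Proof.
move=> us es; apply/permP/uniq_perm => // [|z]; first exact: uniq_nbrs.
by rewrite mem_nbrs es.
Qed.

(** [u], [v], [b], [b'] span five edges, all pairs but [b b']. A fifth neighbour of [a] lies outside
    the block, so it misses both hubs and adds only edges to [b] and [b']. *)
Lemma block_outer u v a a' b b' : block u v a a' b b' ->
  exists R, [/\ size R <= 1, uniq ([:: u; v; b; b'] ++ R),
    forall y, e a y = (y \in [:: u; v; b; b'] ++ R),
    forall y, y \in R -> e u y = false /\ e v y = false &
    tri a = 5 + count (e b) R + count (e b') R].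
Proof.
case=> us ol eu ev; move: (ol).
move=> /and5P[va va' vb vb'] /and5P[ab ab' a'b a'b' /andP[/negPf aa' /negPf bb']].
have [ua ua' ub ub'] : [/\ e u a, e u a', e u b & e u b'].
  by rewrite !eu !inE !eqxx !orbT.
have uv : e u v by rewrite eu inE eqxx.
have [||R [uR sR eR tR]] := @extend_nbrs a [:: u; v; b; b'].
- have := us; rewrite (uniq_catCA [:: u; v] [:: a; a'] [:: b; b']) cat_uniq.
  by case/and3P.
- by rewrite /= (sym a u) (sym a v) ua va ab ab'.
have euR y : y \in R -> e u y = false /\ e v y = false.
  move=> yR; move: (uR); rewrite cat_uniq => /and3P[_ /hasPn/(_ _ yR) + _].
  rewrite /= !inE !negb_or => /and4P[yu yv yb yb'].
  have eay : e a y by rewrite eR mem_cat yR orbT.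
  have ya : y != a by apply: contraTneq eay => ->; rewrite irr.
  have ya' : y != a' by apply: contraTneq eay => ->; rewrite aa'.
  by rewrite eu ev !inE (negPf yu) (negPf yv) (negPf yb) (negPf yb') (negPf ya) (negPf ya').
exists R; split=> //; rewrite tR /= uv ub ub' vb vb' bb'.
move: sR euR; case: R {uR eR tR} => [|x [|//]] //= _ /(_ x (mem_head _ _)) [-> ->].
by case: (e b x); case: (e b' x).
Qed.

Lemma block_outer_tri_le7 u v a a' b b' : block u v a a' b b' -> tri a <= 7.
Proof.
case/block_outer => R [+ _ _ _ ->]; case: R => [|x [|//]] //= _.
by case: (e b x); case: (e b' x).
Qed.

(** A neighbour of [a] outside the block shares at most [b] and [b'] with [a], so its [tri] is at
    most 2 + 5; on the cycle [tri] is at most 7 too. *)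
Lemma block_outer_adj u v a a' b b' w :
  block u v a a' b b' -> e a w -> tri w = 8 -> w = u \/ w = v.
Proof.
move=> B eaw w8; have [R [sR uR eR euR tR]] := block_outer B.
have b7 := block_outer_tri_le7 (block_rot B).
have b'7 := block_outer_tri_le7 (block_swap (block_rot B)).
have := eaw; rewrite eR mem_cat !inE -!orbA.
case/or4P => [/eqP|/eqP|/eqP E|]; [by left|by right|by move: b7; rewrite -E w8|].
case/orP => [/eqP E|wR]; first by move: b'7; rewrite -E w8.
have [uw vw] := euR w wR.
have : tri w <= codeg w a + 5 by apply: tri_le_codeg; rewrite sym.
rewrite w8 codegC (codegE _ uR eR) count_cat /= (sym w u) (sym w v) uw vw.
move: sR wR; case: R {uR eR euR tR} => [|x [|//]] //= _; rewrite inE => /eqP<-.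
by rewrite irr; case: (e w b); case: (e w b').
Qed.

(** The value 7 forces a fifth neighbour [x] of [a] that also sees [b] and [b']. These three then
    have full degree, so another neighbour of [x] meets them only if it is [a'], which is then full
    as well. The link of [x] has the edges [a b], [a b'], and beyond them either [a' b], [a' b'] or
    at most one edge. *)
Lemma block_apex u v a a' b b' : block u v a a' b b' -> tri a = 7 ->
  exists2 x, e a x & tri x <= 4.
Proof.
move=> B a7; have [R [sR uR eR euR tR]] := block_outer B.
move: sR uR eR euR tR; rewrite a7.
case: R => [|x [|//]] // _ uR eR /(_ x (mem_head _ _)) [ux vx].
rewrite /= !addn0 => tR.
have [bx b'x] : e b x /\ e b' x by move: tR; case: (e b x); case: (e b' x).
have eax : e a x by rewrite eR !inE eqxx !orbT.
(* A cycle vertex adjacent to [x] has [x] as its fifth and last neighbour. *)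
have full c c' d d' : block u v c c' d d' -> e c x ->
    forall y, e c y = (y \in [:: u; v; d; d'; x]).
  case=> us' ol' eu ev ecx; have [|R' [+ _ eR' _ _]] := @block_outer u v c c' d d'.
    by [].
  have xn : x \notin [:: u; v; d; d'].
    have : x \notin [:: v; c; c'; d; d'] by rewrite -eu ux.
    have : x \notin [:: u; c; c'; d; d'] by rewrite -ev vx.
    rewrite !inE !negb_or => /and5P[-> _ _ -> ->].
    by case/andP=> ->.
  have := ecx; rewrite eR' mem_cat (negPf xn) /=.
  case: R' eR' => [|z [|//]] // eR'; rewrite inE => /eqP-> _ y.
  exact: eR'.
have B' := block_swap B; have ea := full _ _ _ _ B eax.
have eb := full _ _ _ _ (block_rot B) bx.
have eb' := full _ _ _ _ (block_swap (block_rot B)) b'x.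
exists x => // {uR eR tR}; case: (B) => us ol _ _; move: ol.
move=> /and5P[_ _ _ _ /and5P[ab ab' a'b a'b' /andP[/negPf aa' /negPf bb']]].
have [||R [uR sR eR ->]] := @extend_nbrs x [:: a; b; b'].
- by case/and3P: us => _ _ /= /and3P[]; rewrite !inE !negb_or => /and3P[_ -> ->] _ ->.
- by rewrite /= !(sym x) eax bx b'x.
have RP r : r \in R -> [/\ e a r = false, e b r = (r == a'), e b' r = (r == a') &
    r == a' -> forall s, s \in R -> e r s = false].
  have disj s : s \in R -> (s != a) && (s \notin [:: u; v; b; b'; x]).
    move=> sinR; have exs : e x s by rewrite eR mem_cat sinR orbT.
    move: uR; rewrite cat_uniq => /and3P[_ /hasPn/(_ _ sinR) + _].
    rewrite /= !inE !negb_or => /and3P[-> -> ->] /=.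
    apply/and3P; split; apply: contraTneq exs => ->.
    - by rewrite sym ux.
    - by rewrite sym vx.
    by rewrite irr.
  move=> rR; have exr : e x r by rewrite eR mem_cat rR orbT.
  have /andP[/negPf ra] := disj r rR; rewrite -ea => /negPf ear.
  have := disj r rR; rewrite !inE !negb_or => /andP[_ /and5P[/negPf ru /negPf rv _ _ /negPf rx]].
  split=> //.
  - by rewrite eb !inE ru rv rx ra orbF.
  - by rewrite eb' !inE ru rv rx ra orbF.
  move=> /eqP ra' s sinR; have /andP[_] := disj s sinR.
  by rewrite ra' in exr *; rewrite -(full _ _ _ _ B') 1?sym // => /negPf.
move: sR uR RP; rewrite /= ab ab' bb'; case: R {eR} => [|r [|s [|//]]] //= _ uR RP.
  have [-> -> -> _] := RP r (mem_head _ _).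
  by case: (r == a').
have [-> -> -> rs] := RP r (mem_head _ _).
have sin : s \in [:: r; s] by rewrite !inE eqxx orbT.
have [-> -> -> sr] := RP s sin.
have rs' : r != s by move: uR; rewrite !inE !negb_or => /and5P[].
case: (r =P a') rs sr rs' => [<- rs _ /negPf | _ _ sr _].
  by rewrite eq_sym => ->; rewrite rs.
case: (s =P a') sr => [_ sr|_ _]; last by case: (e r s).
by rewrite sym sr // mem_head.
Qed.

(** * Neighbours of a vertex with [tri] equal to 7 *)

(** Take [w = p]. Both [v] and [h] have full degree, so the at most two neighbours of [p] beyond
    [v], [h], [q] miss them both; the link of [p] is the triangle [v h q] plus at most three
    edges. *)
Lemma cone_link_tri v s :
  uniq s -> (forall y, e v y = (y \in s)) -> coned_link e s ->
  exists2 w, e v w & tri w <= 6.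
Proof.
case: s => [|h [|p [|q [|y [|z [|//]]]]]] // us ev.
move=> /and5P[hp hq hy hz /and3P[pq /negPf py /negPf pz]].
have [vh vp vq] : [/\ e v h, e v p & e v q] by rewrite !ev !inE !eqxx !orbT.
have uv w : w \in [:: h; p; q; y; z] -> (v == w) = false.
  by rewrite -ev; apply: contraTF => /eqP <-; rewrite irr.
have eh w : e h w = (w \in [:: v; p; q; y; z]).
  have [||R [_ + -> _]] := @extend_nbrs h [:: v; p; q; y; z].
  - have us' : uniq [:: p; q; y; z] by case/andP: us.
    rewrite cons_uniq us' andbT.
    by apply/negP => vs; have := uv v; rewrite eqxx inE vs orbT => /(_ isT).
  - by rewrite /= sym vh hp hq hy hz.
  by rewrite leqn0 => /nilP ->; rewrite cats0.
exists p => //.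
have [||R [uR sR eR ->]] := @extend_nbrs p [:: v; h; q].
- rewrite /= !inE !uv ?inE ?eqxx ?orbT //=.
  by move: us; rewrite /= !inE !negb_or => /andP[/and4P[_ -> _ _] _].
- by rewrite /= !(sym p) vp hp sym pq.
have RP r : r \in R -> e v r = false /\ e h r = false.
  move=> rR; have epr : e p r by rewrite eR mem_cat rR orbT.
  move: uR; rewrite cat_uniq => /and3P[_ /hasPn/(_ _ rR) + _].
  rewrite /= !inE !negb_or => /and3P[/negPf rv /negPf rh /negPf rq].
  have [rp ry rz] : [/\ r == p = false, r == y = false & r == z = false].
    by split; apply: contraTF epr => /eqP ->; rewrite ?irr ?py ?pz.
  by rewrite ev eh !inE rv rh rq rp ry rz.
move: sR RP; rewrite /= vh vq hq; case: R {uR eR} => [|r [|s [|//]]] //= _ RP.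
  by have [-> ->] := RP r (mem_head _ _); case: (e q r).
have [-> ->] := RP r (mem_head _ _).
have [|-> ->] := RP s; first by rewrite !inE eqxx orbT.
by case: (e q r); case: (e q s); case: (e r s).
Qed.

(** If [q] and [q'] both have [tri] 7, then [p] turns out to have 8. Such a witness is excluded only
    later, by the hypothesis of [tri7_neighbor]. *)
Lemma coneless_link_tri v s :
  uniq s -> (forall y, e v y = (y \in s)) -> coneless_link e s ->
  exists w, [/\ e v w, tri w != 7 & tri w <= 8].
Proof.
case: s => [|p [|p' [|p'' [|q [|q' [|//]]]]]] // us ev.
move=> /and5P[pp' pq pq' p'q /and5P[p'q' p''q p''q' /negPf pp'' /andP[/negPf p'p'' /negPf qq']]].
have uv w : w \in [:: p; p'; p''; q; q'] -> (v == w) = false.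
  by rewrite -ev; apply: contraTF => /eqP <-; rewrite irr.
have [vp vp' vp'' vq vq'] : [/\ e v p, e v p', e v p'', e v q & e v q'].
  by rewrite !ev !inE !eqxx !orbT.
have [q7|] := eqVneq (tri q) 7; last by exists q; rewrite tri_le8.
have [q'7|] := eqVneq (tri q') 7; last by exists q'; rewrite tri_le8.
exists p; rewrite vp tri_le8; split=> //.
(* The fifth neighbours of [q] and [q'] must be adjacent to all of [p p' p''];
   since [p] has degree 5 they coincide, which fills up the link of [p]. *)
have fill x : e v x -> e x p -> e x p' -> e x p'' ->
    (forall y, e v y -> e x y -> y \in [:: p; p'; p'']) ->
    tri x = 7 -> exists r, [/\ r != v, e x r, ~~ e v r, e p r & e p' r].
  move=> vx xp xp' xp'' ex x7.
  have [||R [uR sR eR]] := @extend_nbrs x [:: v; p; p'; p''].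
  - rewrite cons_uniq; apply/andP; split.
      by rewrite !inE !uv ?inE ?eqxx ?orbT.
    move: us; rewrite -[[:: p; _; _; _; _]]/([:: p; p'; p''] ++ [:: q; q']).
    by rewrite cat_uniq => /andP[].
  - by rewrite /= sym vx xp xp' xp''.
  rewrite x7 /= vp vp' vp'' pp' pp'' p'p''.
  case: R uR sR eR => [|r [|//]] // uR _ eR /=.
  have xr : e x r by rewrite eR !inE eqxx !orbT.
  have vr : e v r = false.
    apply: contraTF uR => /ex/(_ xr); rewrite /= !inE.
    by case/or3P=> /eqP->; rewrite eqxx /= ?orbT ?andbF.
  rewrite vr => E; exists r; rewrite xr vr; split=> //.
    by apply: contraTneq uR => ->; rewrite /= !inE eqxx !orbT.
    by move: E; case: (e p r); case: (e p' r); case: (e p'' r).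
  by move: E; case: (e p r); case: (e p' r); case: (e p'' r).
have [||||||r [rv qr vr pr p'r]] := fill q; rewrite ?(sym q) //.
  move=> y; rewrite ev !inE => /or4P[->|->|->|/orP[]/eqP->]; rewrite ?orbT ?irr ?qq' //.
have [||||||r' [r'v q'r' vr' pr' p'r']] := fill q'; rewrite ?(sym q') //.
  move=> y; rewrite ev !inE => /or4P[->|->|->|/orP[]/eqP->]; rewrite ?orbT ?irr 1?sym ?qq' //.
have nv w w' : e v w -> ~~ e v w' -> (w' == w) = false.
  by move=> vw; apply: contraNF => /eqP->.
have [||R [_ + eR ->]] := @extend_nbrs p [:: v; p'; q; q'; r].
- rewrite /= !inE (uv p') ?(uv q) ?(uv q') ?inE ?eqxx ?orbT //= (eq_sym v) (negPf rv).
  move: us; rewrite /= !inE !negb_or !(eq_sym _ r).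
  case/and5P=> _ /and3P[_ -> ->] _ -> _.
  by rewrite !(nv _ _ _ vr).
- by rewrite /= pp' pq pq' pr sym vp.
rewrite leqn0 => /nilP R0; have : e p r' by [].
rewrite eR R0 cats0 !inE (negPf r'v) (nv p') ?(nv q) ?(nv q') //= => /eqP r'r.
by rewrite /= vp' vq vq' (negPf vr) p'q p'q' p'r qq' qr -r'r q'r'.
Qed.

Lemma tri7_neighbor v : tri v = 7 -> (forall w, e v w -> tri w != 8) ->
  exists2 w, e v w & tri w <= 6.
Proof.
move=> v7 n8; have [|s [us ev]] := @dense_linkE v; first by rewrite v7.
rewrite /dense_link -(tri_edges us ev) v7 /= => /orP[/(cone_link_tri us ev)//|].
case/(coneless_link_tri us ev) => w [vw w7 w8]; exists w => //.
by have := n8 w vw; lia.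
Qed.

(** * Discharging *)

(** For [tri x < 8] this says that [x] is a cycle vertex of some block; see [near8_block]. *)
Definition near8 x := [exists y, e x y && (tri y == 8)].

(** The doubled boolean is 2 for a cycle vertex and 0 for the twin hub. *)
Definition give x y : nat :=
  if tri x == 8 then (tri y < 8).*2
  else if tri x == 7 then
    if tri y <= 4 then 5 else (tri y <= 6) && ~~ near8 x
  else 0.

Lemma sum_nbrs_const x (F : T -> nat) c :
  (forall y, e x y -> F y <= c) -> \sum_(y | e x y) F y <= 5 * c.
Proof.
move=> Fc; apply: leq_trans (leq_sum _ Fc) _.
by rewrite sum_nat_const leq_mul2r -cardsE deg_le5 orbT.
Qed.

Lemma sum_nbrs x s (F : T -> nat) : uniq s -> (forall y, e x y = (y \in s)) ->
  \sum_(y | e x y) F y = \sum_(y <- s) F y.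
Proof.
by move=> us es; rewrite (eq_bigl _ _ es) big_uniq.
Qed.

Lemma near8_block x : tri x < 8 -> near8 x ->
  exists u v x' y y', block u v x x' y y'.
Proof.
move=> x8 /existsP[u /andP[+ /eqP/tri8_block[v [a [a' [b [b' B]]]]]]].
have [_ v8] := block_tri B; case: (B) => _ _ eu _; rewrite sym eu !inE.
have [xv | _ /=] := eqVneq x v; first by rewrite xv v8 in x8.
case/or4P => /eqP E; rewrite -?E in B *.
- by exists u, v, a', b, b'.
- by exists u, v, a, b, b'; apply: block_swap.
- by exists u, v, b', a, a'; apply: block_rot.
by exists u, v, b, a, a'; apply/block_swap/block_rot.
Qed.

(** Each hub gives at most 2. The two cycle neighbours give nothing, being in a block themselves.
    The outside neighbour gives at most 1, and nothing if [tri x] is 7, which makes room for the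
    extra term. *)
Lemma near8_received x : tri x < 8 -> near8 x ->
  \sum_(y | e x y) give y x + (tri x == 7) <= 5.
Proof.
move=> x8 /(near8_block x8) [u [v [x' [y [y' B]]]]].
have [R [sR uR eR euR tR]] := block_outer B.
have x4 : 4 < tri x by rewrite tR.
have x4' : (tri x <= 4) = false by rewrite leqNgt x4.
rewrite (sum_nbrs _ uR eR) big_cat /= !big_cons big_nil.
have give_u w : give w x <= 2.
  by rewrite /give x8 x4'; do 2?[case: ifP => // _]; case: (_ && _).
have give0 c c' d d' : block u v c c' d d' -> give c x = 0.
  move=> B'; have := block_outer_tri_le7 B'; rewrite /give x4' /=.
  have -> : near8 c.
    apply/existsP; exists u; rewrite (block_tri B').1 eqxx andbT sym.
    by case: B' => _ _ -> _; rewrite !inE eqxx !orbT.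
  by move=> c7; rewrite ltn_eqF // andbF if_same.
rewrite (give0 _ _ _ _ (block_rot B)) (give0 _ _ _ _ (block_swap (block_rot B))).
have : \sum_(w <- R) give w x + (tri x == 7) <= 1.
  case: R sR {uR} eR euR {tR} => [|w [|//]] _ eR euR.
    by rewrite big_nil; case: (_ == _).
  rewrite big_cons big_nil addn0; have [uw vw] := euR w (mem_head _ _).
  have xw : e x w by rewrite eR !inE eqxx !orbT.
  have w8 : tri w != 8.
    apply/eqP => /(block_outer_adj B xw) wuv; case: B => _ _ eu ev.
    by case: wuv => E; move: vw uw; rewrite ?eu ?ev E !inE eqxx.
  rewrite /give (negPf w8) x4' /=; case: (tri x =P 7) => [-> | _].
    by case: ifP.
  by rewrite addn0; case: ifP => // _; case: (_ && _).
by have := give_u u; have := give_u v; lia.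
Qed.

Lemma discharge x :
  7 * tri x + \sum_(y | e x y) give y x <= 48 + \sum_(y | e x y) give x y.
Proof.
have [x4|x4] := leqP (tri x) 4.
  (* A neighbour [y] with [tri y >= 7] shares two neighbours with [x]. *)
  suff : \sum_(y | e x y) give y x <= 5 * tri x.
    move=> in5; apply: leq_trans (leq_addr _ _).
    (* Here [(7 + 5) * tri x <= 48] because [tri x <= 4]. *)
    by apply: leq_trans (leq_add (leqnn _) in5) _; lia.
  (* Doubling reduces the bound to [2 * give y x <= 5 * codeg x y] for each neighbour [y]. *)
  rewrite -leq_double doubleMr -sum_codeg -mul2n !big_distrr /=; apply: leq_sum => y exy.
  have : tri y <= codeg x y + 5 by rewrite codegC tri_le_codeg // sym.
  rewrite /give x4.
  case: eqP => [-> | _]; first by rewrite (leq_ltn_trans x4) //; lia.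
  by case: eqP => [-> | _]; rewrite ?muln0 //; lia.
have [x8|x8] := ltnP (tri x) 8; last first.
  have {x4}x8 : tri x = 8 by apply/eqP; rewrite eqn_leq tri_le8.
  (* Nothing comes in, and the surplus [7 * 8 - 48 = 8] leaves as 2 to each of four cycle
     vertices. *)
  rewrite big1 => [|y _]; last by rewrite /give x8 /=; case: ifP => //; case: ifP.
  have [v [a [a' [b [b' B]]]]] := tri8_block x8.
  have give2 c c' d d' : block x v c c' d d' -> give x c = 2.
    by move/block_outer_tri_le7 => c7; rewrite /give x8 eqxx ltnS c7.
  have [us _ ex _] := B.
  have {}us : uniq [:: v; a; a'; b; b'] by case/andP: us.
  rewrite (sum_nbrs _ us ex) !big_cons big_nil (give2 _ _ _ _ B).
  rewrite (give2 _ _ _ _ (block_swap B)) (give2 _ _ _ _ (block_rot B)).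
  by rewrite (give2 _ _ _ _ (block_swap (block_rot B))) x8; lia.
have [n8|n8] := boolP (near8 x).
  have in5 := near8_received x8 n8.
  have [x7|x7] := eqVneq (tri x) 7; last by move/eqP: x7; lia.
  have [u [v [x' [y [y' B]]]]] := near8_block x8 n8.
  (* The surplus 1 and an income of at most 4 are covered by the 5 sent to the apex. *)
  have [z xz z4] := block_apex B x7.
  have : give x z <= \sum_(y | e x y) give x y by rewrite (bigD1 z) //= leq_addr.
  have -> : give x z = 5 by rewrite /give x7 z4.
  by move: in5; rewrite x7 /=; lia.
have n8' y : e x y -> tri y != 8.
  by move: n8; rewrite negb_exists => /forallP/(_ y); rewrite negb_and => /orP[/negPf->|].
(* Away from blocks, a vertex with [tri] 7 receives nothing and passes on its surplus 1. *)
have [x7|x7] := eqVneq (tri x) 7.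
  rewrite big1 => [|y /n8'/negPf y8]; last by rewrite /give y8 x7 /= if_same.
  have [w xw w6] := tri7_neighbor x7 n8'.
  have : give x w <= \sum_(y | e x y) give x y by rewrite (bigD1 w) //= leq_addr.
  have : 0 < give x w by rewrite /give x7 w6 n8 /=; case: ifP.
  by rewrite x7; lia.
(* Now [tri x] is 5 or 6, and [7 * 6 + 5 <= 48]. *)
have : \sum_(y | e x y) give y x <= 5 * 1.
  apply: sum_nbrs_const => y /n8'/negPf y8; rewrite /give y8 (leqNgt (tri x)) x4.
  by case: ifP => // _; case: (_ && _).
by move/eqP: x7; lia.
Qed.

(** Summed over all vertices, the amounts sent and received cancel in [discharge]. *)
Lemma sum_tri_le : 7 * \sum_x tri x <= 48 * #|T|.
Proof.
rewrite -(leq_add2r (\sum_x \sum_(y | e x y) give x y)) big_distrr /=.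
rewrite {1}(exchange_big_dep xpredT) //= -big_split /= mulnC -sum_nat_const -big_split /=.
apply: leq_sum => x _; apply: leq_trans (discharge x).
by rewrite leq_add2l; apply: eq_leq; apply: eq_bigl => y; rewrite sym.
Qed.

End Graph.

(** * Ordered triples and triangles *)

(** The fibre over a triangle in the count of [sum_ordered_triangles]: the six orderings listed in
    [s]. *)
Lemma card_ordered_triangles (T : finType) (e : rel T) (S : {set T}) :
  symmetric e -> irreflexive e -> #|S| = 3 -> is_clique e S ->
  #|[pred p : T * T * T | [&& e p.1.1 p.1.2, e p.1.1 p.2, e p.1.2 p.2
     & [set p.1.1; p.1.2; p.2] == S]]| = 6.
Proof.
move=> sym irr S3 /'forall_implyP clS.
have := enum_uniq S; have := S3; rewrite cardE.
have : enum S =i S by move=> x; rewrite mem_enum.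
case: (enum S) => [|a [|b [|c [|//]]]] // memS _ us.
have {}clS x y : x \in [:: a; b; c] -> y \in [:: a; b; c] -> x != y -> e x y.
  by rewrite !memS => /clS/'forall_implyP yS /yS/implyP.
move: us; rewrite /= !inE negb_or !andbT => /andP[/andP[ab ac] bc].
pose s := [:: (a, b, c); (a, c, b); (b, a, c); (b, c, a); (c, a, b); (c, b, a)].
rewrite (@eq_card _ _ (mem s)); last first.
  case=> -[x y] z; rewrite !inE /=; apply/idP/idP.
    case/and4P => xy xz yz /eqP SE.
    have [xS yS zS] : [/\ x \in [:: a; b; c], y \in [:: a; b; c] & z \in [:: a; b; c]].
      by rewrite !memS -SE !inE !eqxx !orbT.
    move: xS yS zS xy xz yz; rewrite !inE.
    by case/or3P=> /eqP-> /or3P[]/eqP-> /or3P[]/eqP->; rewrite ?irr // !eqxx ?orbT.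
  have SE : S = [set a; b; c] by apply/setP => w; rewrite -memS !inE orbA.
  have [eab eac ebc] : [/\ e a b, e a c & e b c].
    by split; apply: clS; rewrite ?inE ?eqxx ?orbT.
  rewrite !xpair_eqE => E.
  have {E} : [|| [&& x == a, y == b & z == c], [&& x == a, y == c & z == b],
     [&& x == b, y == a & z == c], [&& x == b, y == c & z == a],
     [&& x == c, y == a & z == b] | [&& x == c, y == b & z == a]].
    by move: E; rewrite -!andbA.
  do 5?[case/orP]; move=> /and3P[/eqP-> /eqP-> /eqP->];
    rewrite ?(sym b a) ?(sym c a) ?(sym c b) ?eab ?eac ?ebc SE /=;
    apply/eqP/setP => w; rewrite !inE; do 3!case: (w == _) => //.
have /card_uniqP-> // : uniq s.
by rewrite /s /= !inE !xpair_eqE !eqxx !(eq_sym b a) !(eq_sym c a) !(eq_sym c b)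
  (negPf ab) (negPf ac) (negPf bc) /= ?andbF.
Qed.

Lemma sum_ordered_triangles (T : finType) (e : rel T) :
  symmetric e -> irreflexive e ->
  \sum_x \sum_y \sum_z [&& e x y, e x z & e y z] = 6 * k_ 3 e.
Proof.
move=> sym irr; rewrite pair_bigA pair_bigA /=.
pose P (p : T * T * T) := [&& e p.1.1 p.1.2, e p.1.1 p.2 & e p.1.2 p.2].
transitivity (\sum_(p | P p) 1).
  by rewrite [RHS]big_mkcond; apply: eq_bigr => p _; rewrite -/(P p); case: (P p).
pose Q (S : {set T}) := (#|S| == 3) && is_clique e S.
rewrite (partition_big (fun p => [set p.1.1; p.1.2; p.2]) Q) => [|[[x y] z]].
  rewrite /k_ mulnC -sum_nat_const [RHS](eq_bigl Q) => [|S]; last by rewrite inE.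
  apply: eq_bigr => S /andP[/eqP S3 cS]; rewrite -(card_ordered_triangles sym irr S3 cS).
  by rewrite sum1_card; apply: eq_card => p; rewrite !inE unfold_in /= -!andbA.
rewrite /P /Q /= => /and3P[xy xz yz].
have ne a b : e a b -> a != b by apply: contraTneq => ->; rewrite irr.
rewrite setUC cardsU1 cards2 !inE negb_or !(eq_sym z) !ne //=.
apply/'forall_implyP => a; rewrite !inE => aS.
apply/'forall_implyP => b; rewrite !inE => bS; apply/implyP.
by move: aS bS => /or3P[]/eqP-> /or3P[]/eqP->;
  rewrite ?eqxx // sym.
Qed.

(** * The extremal graph *)

Lemma Gstar_sym : symmetric Gstar.
Proof.
by do 2![case=> [[|[|[|[|[|[|[|//]]]]]]] ?]].
Qed.

Lemma Gstar_irr : irreflexive Gstar.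
Proof. by case=> [[|[|[|[|[|[|[|//]]]]]]] ?]. Qed.

(** Six times the count is a sum over ordered triples, which evaluates once ordinals are replaced by
    ranges of natural numbers. *)
Lemma k3_Gstar : k_ 3 Gstar = 16.
Proof.
apply/eqP; rewrite -(eqn_pmul2l (isT : 0 < 6)).
rewrite -(sum_ordered_triangles Gstar_sym Gstar_irr).
pose F x y z : nat := [&& Gstar_adj x y, Gstar_adj x z & Gstar_adj y z].
rewrite -(big_mkord xpredT (fun x => \sum_(y < 7) \sum_(z < 7) F x y z)).
under eq_bigr => x _.
  rewrite -(big_mkord xpredT (fun y => \sum_(z < 7) F x y z)).
  under eq_bigr => y _ do rewrite -(big_mkord xpredT (fun z => F x y z)).
  over.
by rewrite unlock.
Qed.

Lemma Gstar_in_class : in_class 5 4 Gstar.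
Proof.
split; first by split; [exact: Gstar_sym | exact: Gstar_irr].
split=> [x|S /'forall_implyP clS].
  rewrite /deg -sum1_card big_mkcond.
  under eq_bigr => y _ do rewrite inE.
  rewrite -(big_mkord xpredT (fun y => if Gstar_adj x y then 1 else 0)).
  by rewrite unlock; case: x => [[|[|[|[|[|[|[|//]]]]]]] ?].
pose m i : nat := inord i \in S.
have nonadj i j : i < 7 -> j < 7 -> i != j -> ~~ Gstar_adj i j -> m i + m j <= 1.
  move=> i7 j7 ij nij; rewrite /m.
  case: (boolP (inord i \in S)) => // iS; case: (boolP (inord j \in S)) => // jS.
  have /'forall_implyP/(_ _ jS)/implyP := clS _ iS.
  by rewrite /Gstar -val_eqE /= !inordK // (negPf nij) ij => /(_ isT).
have -> : #|S| = \sum_(i < 7) m i.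
  rewrite -sum1_card big_mkcond; apply: eq_bigr => i _.
  by rewrite /m inord_val; case: (i \in S).
rewrite -(big_mkord xpredT m) unlock /=.
have m1 i : m i <= 1 by rewrite /m; case: (_ \in _).
(* The pairs 01 and 23 contribute at most 1 each; 4, 5, 6 contribute at most 2, since 6 is adjacent
   to neither 4 nor 5. *)
have := nonadj 0 1 isT isT isT isT; have := nonadj 2 3 isT isT isT isT.
have := nonadj 4 6 isT isT isT isT; have := nonadj 5 6 isT isT isT isT.
by have := m1 4; have := m1 5; lia.
Qed.

(** * The density bound *)

(** Twice the edge count of the link of [x] is the number of ordered triangles starting at [x]. *)
Lemma sum_tri (T : finType) (e : rel T) :
  symmetric e -> irreflexive e -> \sum_x tri e x = 3 * k_ 3 e.
Proof.
move=> sym irr; apply: double_inj; rewrite -[RHS]mul2n mulnA -[2 * 3]/6.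
rewrite -(sum_ordered_triangles sym irr).
rewrite -mul2n big_distrr; apply: eq_bigr => x _; rewrite /= mul2n -sum_codeg //.
rewrite big_mkcond; apply: eq_bigr => y _; case: ifP => [exy | _]; last by rewrite big1.
rewrite /codeg -sum_count big_enum big_mkcond; apply: eq_bigr => z _.
by rewrite inE; case: (e x z).
Qed.

Lemma k3_le (T : finType) (e : rel T) : in_class 5 4 e -> 7 * k_ 3 e <= 16 * #|T|.
Proof.
move=> [[sym irr] [deg5 cl4]]; have := sum_tri_le sym irr deg5 cl4.
by rewrite sum_tri //; lia.
Qed.

Lemma rho3_Gstar : rho_ 3 Gstar = (16%:R / 7%:R)%R.
Proof. by rewrite /rho_ k3_Gstar card_ord. Qed.

Theorem mainTheorem19 :
  f_eq 3 5 4 (16%:R / 7%:R : rat) /\ rho_ 3 Gstar = (16%:R / 7%:R : rat).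
Proof.
split; last exact: rho3_Gstar.
split=> [T e cl T0 | r le_r]; last first.
  (* Any upper bound is at least the density of [Gstar], a member of the class. *)
  by rewrite -rho3_Gstar; apply: le_r; [exact: Gstar_in_class | rewrite card_ord].
rewrite /rho_ ler_pdivrMr ?ltr0n // mulrAC ler_pdivlMr ?ltr0n //.
by rewrite -!natrM ler_nat mulnC; apply: k3_le.
Qed.
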